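(* Let $R$ be a domain, and let $I\subset R$ be an ideal. Then we have: (a) If $I$ is generated by $m$ elements, then $\mathrm{tr}(I)^{m-j}\subseteq \mathrm{Fitt}_j(I)$ for all $j$. (b) If $I$ is generated by $2$ elements, then $\mathrm{Fitt}_1(I)=\mathrm{tr}(I)$.
   Context: Rings are commutative with unit and Noetherian. For a finitely generated module $M$ over a Noetherian ring $R$, choose a finite free presentation $G\to F\to M\to 0$ with $\mathrm{rank}\,F=r$, and let $A$ be a matrix representing $G\to F$. The $j$th Fitting ideal of $M$ is $\mathrm{Fitt}_j(M)=I_{r-j}(A)$, where $I_t(A)$ is the ideal generated by the $t$-minors of $A$, with $I_t(A)=R$ for $t\le 0$. This is independent of the choices. An ideal $I$ is regarded as an $R$-module. The trace of an $R$-module $M$ is the ideal $\mathrm{tr}(M)=\sum_{\varphi\in \mathrm{Hom}_R(M,R)}\varphi(M)$.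
   Formalization: Part (a) is stated for j ≥ 1, or for I = 0 with any j ≥ 0, since for j = 0 and I nonzero Fitt_0(I) = 0 while tr(I)^m is nonzero; part (b) assumes I is nonzero, since Fitt_1(0) = R while tr(0) = 0. *)

(* Defs.v *)
From HB Require Import structures.
From mathcomp Require Import all_boot all_order all_algebra.
From mathcomp Require Import boolp classical_sets.

Set Implicit Arguments.
Unset Strict Implicit.
Unset Printing Implicit Defensive.

Import GRing.Theory.

Local Open Scope classical_set_scope.
Local Open Scope ring_scope.

Section Submodule.
Variables (R : comNzRingType) (M : lmodType R) (N : submodClosed M).

Record submodule := Submodule {submodule_val : M; _ : submodule_val \in N}.

HB.instance Definition _ := [isSub for submodule_val].
HB.instance Definition _ := [Choice of submodule by <:].
HB.instance Definition _ := [SubChoice_isSubLmodule of submodule by <:].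

End Submodule.

Section Ideals.
Variable R : comNzRingType.

(* Ideals of R are the submodules of the regular module R^o; the improper
   ideal R is one of them, unlike in mathcomp's ring_quotient. *)
Notation ideal := (submodClosed R^o).

Definition generated_by (m : nat) (I : ideal) : Prop :=
  exists g : 'I_m -> R, forall x : R,
    x \in I <-> exists c : 'I_m -> R, x = \sum_(i < m) c i * g i.

Definition noetherian : Prop := forall I : ideal, exists m, generated_by m I.

Definition ideal_span (S : set R) : set R :=
  [set x | exists (n : nat) (c s : 'I_n -> R),
     (forall i, S (s i)) /\ x = \sum_(i < n) c i * s i].

(* The 0th power is the unit ideal, because the empty product is 1. *)
Definition ideal_power (J : set R) (n : nat) : set R :=
  ideal_span [set x | exists2 f : 'I_n -> R,
                (forall i, J (f i)) & x = \prod_(i < n) f i].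

(* For t = 0 the only minor is 1, so that minors_ideal 0 A is the unit ideal.
   Rows and columns may be listed in any order, which only affects signs. *)
Definition minors_ideal (s r : nat) (t : nat) (A : 'M[R]_(s, r)) : set R :=
  ideal_span [set x | exists (f : 'I_t -> 'I_s) (g : 'I_t -> 'I_r),
                [/\ injective f, injective g & x = \det (mxsub f g A)]].

End Ideals.

Section Modules.
Variables (R : comNzRingType) (M : lmodType R).

(* Exactness of R^s -> R^r -> M -> 0, where elements of free modules are row
   vectors and A acts on the right. *)
Definition presents (s r : nat) (A : 'M[R]_(s, r)) : Prop :=
  exists p : {linear 'rV[R]_r -> M},
    (forall y : M, exists v, p v = y) /\
    (forall v, p v = 0 <-> exists u : 'rV[R]_s, v = u *m A).

(* The value computed from a chosen finite free presentation; it is junk if M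
   has none. The truncated r - j accounts for I_t(A) = R when t <= 0. *)
Definition fitting (j : nat) : set R :=
  get [set J : set R | exists (s r : nat) (A : 'M[R]_(s, r)),
         presents A /\ J = minors_ideal (r - j) A].

Definition trace : set R :=
  [set a | exists (n : nat) (phi : 'I_n -> {linear M -> R^o}) (x : 'I_n -> M),
     a = \sum_(i < n) phi i (x i)].

End Modules.

(* Main.v *)
Require Import Defs.
From HB Require Import structures.
From mathcomp Require Import all_boot all_order all_algebra.
From mathcomp Require Import boolp classical_sets.
From mathcomp Require Import perm zify ring.

(** Both parts rest on Fitting's lemma in a form with an inclusion: if [A]
   presents [M] on [r] generators and the rows of [B] are some relations among
   [m] generators of [M], then the [(m - j)]-minors of [B] lie in the ideal of
   [(r - j)]-minors of [A] ([fitting_lemma]). Over a Noetherian ring a finitely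
   generated module has a finite presentation ([noetherian_kernel]), so the
   Fitting ideal is computed by some matrix [A], and it is enough to compare [A]
   with relations that are convenient.

   For (a), let [G 0, ..., G (m-1)] generate [I]. A linear form [phi] on [I]
   satisfies [phi x *: y = phi y *: x], so any two generators are tied by the
   relation [phi (G i) e_b - phi (G b) e_i]. The trace is generated by the
   values [phi (G i)], so an element of its [n]-th power, [n = m - j], is a
   combination of products of [n] such values [phi_l (G (h l))]. Take the
   relation above for [phi_l], [h l] and a column [b l]. If the [b l] are
   distinct and [b l] avoids the indices [h k] with [l <= k], then on the columns
   [b] these relations form a triangular matrix whose diagonal entries are the
   factors of the product ([trace_power_sub_minors]). A greedy choice of [b] works as long as [n < m],
   which holds when [n] and [j] are positive ([avoiding_injection]); for [n = 0]
   there is nothing to choose.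

   For (b), one inclusion is (a) with [m = 2] and [j = 1]. Conversely Fitting's
   lemma, applied in the other direction, puts [Fitt_1] into the ideal generated
   by the entries of the relations [(c0, c1)] between two generators. In a
   domain, if [I] is nonzero, such a relation is itself the pair of values of a
   linear form on [I], sending the generators to [c1] and [- c0]
   ([relation_entry_trace]). *)

Set Implicit Arguments.
Unset Strict Implicit.
Unset Printing Implicit Defensive.

Import GRing.Theory.

Local Open Scope classical_set_scope.
Local Open Scope ring_scope.

(** * Spans of sets of ring elements *)

Section IdealSpan.
Variables (R : comNzRingType) (S : set R).

Lemma sub_ideal_span : S `<=` ideal_span S.
Proof.
move=> x Sx; exists 1, (fun=> 1), (fun=> x); split=> //.
by rewrite big_ord1 mul1r.
Qed.

Lemma ideal_span0 : ideal_span S 0.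
Proof.
exists 0, (fun=> 0), (fun=> 0).
by split; [case | rewrite big_ord0].
Qed.

Lemma ideal_spanD x y :
  ideal_span S x -> ideal_span S y -> ideal_span S (x + y).
Proof.
move=> [n1 [c1 [s1 [Ss1 ->]]]] [n2 [c2 [s2 [Ss2 ->]]]].
pose glue (u : 'I_n1 -> R) v (i : 'I_(n1 + n2)) :=
  match split i with inl j => u j | inr j => v j end.
exists (n1 + n2)%N, (glue c1 c2), (glue s1 s2); split.
  by move=> i; rewrite /glue; case: (split i).
rewrite big_split_ord; congr (_ + _); apply: eq_bigr => i _; rewrite /glue.
  by rewrite (unsplitK (inl i)).
by rewrite (unsplitK (inr i)).
Qed.

Lemma ideal_spanM a x : ideal_span S x -> ideal_span S (a * x).
Proof.
move=> [n [c [s [Ss ->]]]]; exists n, (fun i => a * c i), s; split=> //.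
by rewrite big_distrr; apply: eq_bigr => i _; rewrite /= mulrA.
Qed.

Lemma ideal_span_sum (I : finType) (F : I -> R) :
  (forall i, ideal_span S (F i)) -> ideal_span S (\sum_i F i).
Proof.
move=> SF; elim/big_rec: _ => [|i x _]; first exact: ideal_span0.
exact: ideal_spanD.
Qed.

Lemma ideal_span_subset (T : set R) :
  T `<=` ideal_span S -> ideal_span T `<=` ideal_span S.
Proof.
move=> TS _ [n [c [s [Ts ->]]]]; apply: ideal_span_sum => i.
by apply/ideal_spanM/TS.
Qed.

End IdealSpan.

(** * Ideals of minors *)

Section Minors.
Variable R : comNzRingType.

(** The rows of [U *m N] are combinations of the rows of [N], and the
   determinant is multilinear in rows. This is the Cauchy-Binet formula before
   its terms are grouped by the image of [h]. *)
Lemma det_mulmx_rows t s (U : 'M[R]_(t, s)) (N : 'M[R]_(s, t)) :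
  \det (U *m N) =
    \sum_(h : {ffun 'I_t -> 'I_s}) (\prod_i U i (h i)) * \det (rowsub h N).
Proof.
rewrite /determinant.
under [RHS]eq_bigr => h _ do rewrite big_distrr /=.
rewrite exchange_big; apply: eq_bigr => /= sg _.
under eq_bigr => i _ do rewrite mxE.
rewrite (bigA_distr_bigA (fun i j => U i j * N j (sg i))) big_distrr /=.
apply: eq_bigr => h _; rewrite big_split /= mulrCA; congr (_ * (_ * _)).
by apply: eq_bigr => i _; rewrite mxE.
Qed.

Lemma det_mxsub_noninj t s r (A : 'M[R]_(s, r)) (f : 'I_t -> 'I_s)
    (g : 'I_t -> 'I_r) :
  ~ (injective f /\ injective g) -> \det (mxsub f g A) = 0.
Proof.
have nonrow t' s' r' (B : 'M[R]_(s', r')) (f' : 'I_t' -> 'I_s') g' :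
    ~ injective f' -> \det (mxsub f' g' B) = 0.
  move=> /injectiveP/injectivePn[i [j ij fij]].
  by apply: (determinant_alternate ij) => l; rewrite !mxE fij.
move=> ninj; case: (EM (injective f)) => [finj|]; last exact: nonrow.
rewrite -det_tr (_ : _^T = mxsub g f A^T); last first.
  by apply/matrixP=> i j; rewrite !mxE.
by apply: nonrow => ginj; apply: ninj.
Qed.

(** For index maps that are not injective the determinant is [0], so that the
   expansions below need not keep track of injectivity. *)
Lemma minor_in_ideal t s r (A : 'M[R]_(s, r)) (f : 'I_t -> 'I_s)
    (g : 'I_t -> 'I_r) : minors_ideal t A (\det (mxsub f g A)).
Proof.
case: (EM (injective f /\ injective g)) => [[finj ginj]|ninj].
  by apply: sub_ideal_span; exists f, g.
by rewrite det_mxsub_noninj //; apply: ideal_span0.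
Qed.

Lemma cofactor_mxsub t s r (A : 'M[R]_(s, r)) (f : 'I_t.+1 -> 'I_s)
    (g : 'I_t.+1 -> 'I_r) i j :
  cofactor (mxsub f g A) i j =
    (-1) ^+ (i + j) * \det (mxsub (f \o lift i) (g \o lift j) A).
Proof. by congr (_ * \det _); apply/matrixP=> a b; rewrite !mxE. Qed.

Lemma minors_ideal_leq k t s r (A : 'M[R]_(s, r)) :
  (k <= t)%N -> minors_ideal t A `<=` minors_ideal k A.
Proof.
move=> /subnK <-; elim: (t - k)%N => [|d IHd] //.
apply: subset_trans IHd; apply: ideal_span_subset => _ [f [g [_ _ ->]]].
rewrite (expand_det_row _ ord0); apply: ideal_span_sum => j.
by rewrite cofactor_mxsub; do 2 apply: ideal_spanM; apply: minor_in_ideal.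
Qed.

Lemma minors_ideal0 s r (A : 'M[R]_(s, r)) x : minors_ideal 0 A x.
Proof.
rewrite -[x]mulr1 -(det_mx00 (mxsub (@widen_ord 0 s isT) (@widen_ord 0 r isT) A)).
by apply: ideal_spanM; apply: minor_in_ideal.
Qed.

(** Laplace expansion along a row from the lower blocks lowers both the size of
   the minor and the number of such rows; once none is left, the minor is one of
   [A], or has a zero column. *)
Lemma minor_block_lower s r m n (A : 'M[R]_(s, r)) (C : 'M[R]_(m, r))
    (D : 'M[R]_(m, n)) k t (f : 'I_t -> 'I_(s + m)) (g : 'I_t -> 'I_(r + n)) :
  (k + \sum_(i < t) (s <= f i) <= t)%N ->
  minors_ideal k A (\det (mxsub f g (block_mx A 0 C D))).
Proof.
elim: t f g => [|t IHt] f g.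
  by rewrite leqn0 addn_eq0 => /andP[/eqP-> _]; apply: minors_ideal0.
case: (pickP (fun i => s <= f i)%N) => [i sfi | upper] kt.
  move: kt; rewrite (bigD1_ord i) //= sfi addnCA ltnS => kt.
  rewrite (expand_det_row _ i); apply: ideal_span_sum => j.
  by rewrite cofactor_mxsub; do 2 apply: ideal_spanM; apply: IHt.
have kt1 : (k <= t.+1)%N by apply: leq_trans kt; apply: leq_addr.
have fs i : (f i < s)%N by rewrite ltnNge upper.
case: (pickP (fun j => r <= g j)%N) => [j rgj | left].
  rewrite (expand_det_col _ j) big1; first exact: ideal_span0.
  move=> i _; rewrite !mxE; case: splitP => [a fia|a fia]; last first.
    by have := fs i; rewrite fia ltnNge leq_addr.
  rewrite mxE; case: splitP => [b gjb|b gjb]; last by rewrite mxE mul0r.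
  by have := ltn_ord b; rewrite -gjb ltnNge rgj.
have gr j : (g j < r)%N by rewrite ltnNge left.
rewrite (_ : mxsub f g _ =
  mxsub (fun i => Ordinal (fs i)) (fun j => Ordinal (gr j)) A).
  by apply: (minors_ideal_leq kt1); apply: minor_in_ideal.
apply/matrixP=> i j; rewrite [LHS]mxE [RHS]mxE -[RHS](block_mxEul A 0 C D).
by congr (fun_of_matrix _ _ _); apply: val_inj.
Qed.

Lemma sum_lower_leq s m t (h : 'I_t -> 'I_(s + m)) :
  injective h -> (\sum_(i < t) (s <= h i) <= m)%N.
Proof.
pose F (x : 'I_(s + m)) : nat := (s <= x)%N.
move=> hinj; rewrite -[leqLHS](big_imset F (in2W hinj)) /=.
apply: (@leq_trans (\sum_x F x)).
  by rewrite [leqRHS](bigID (mem (h @: 'I_t))%SET) leq_addr.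
rewrite big_split_ord big1 => [|i _]; last by rewrite /F leqNgt /= ltn_ord.
by under eq_bigr => i _ do rewrite /F leq_addr; rewrite sum1_card card_ord.
Qed.

End Minors.
(** * Presentations and Fitting ideals *)

Section Presentations.
Variables (R : comNzRingType) (M : lmodType R).

Section Combination.
Variables (m : nat) (G : 'I_m -> M).

Definition combination (v : 'rV[R]_m) : M := \sum_i v 0 i *: G i.

Lemma combination_is_linear : linear combination.
Proof.
move=> a u v; rewrite /combination scaler_sumr -big_split /=.
by apply: eq_bigr => i _; rewrite !mxE scalerDl scalerA.
Qed.

HB.instance Definition _ :=
  GRing.isLinear.Build R 'rV[R]_m M *:%R combination combination_is_linear.

End Combination.

Lemma linear_mulmx m r (p : {linear 'rV[R]_r -> M}) (v : 'rV_m)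
    (X : 'M_(m, r)) : p (v *m X) = \sum_i v 0 i *: p (row i X).
Proof.
by rewrite mulmx_sum_row linear_sum; apply: eq_bigr => i _; rewrite linearZ.
Qed.

Lemma linear_delta m (q : {linear 'rV[R]_m -> M}) (v : 'rV_m) :
  q v = \sum_i v 0 i *: q 'e_i.
Proof.
by rewrite {1}[v]row_sum_delta linear_sum; apply: eq_bigr => i _; rewrite linearZ.
Qed.

Lemma lift_linear m r (p : {linear 'rV[R]_r -> M}) (q : {linear 'rV[R]_m -> M}) :
  (forall y, exists v, p v = y) ->
  exists X : 'M[R]_(m, r), forall v : 'rV_m, p (v *m X) = q v.
Proof.
move=> ponto; have [X pX] := choice (fun i => ponto (q 'e_i)).
exists (\matrix_i X i) => v; rewrite linear_mulmx linear_delta.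
by apply: eq_bigr => i _; rewrite rowK pX.
Qed.

Lemma kernel_rows s r (A : 'M[R]_(s, r)) (p : {linear 'rV[R]_r -> M}) n
    (Z : 'M[R]_(n, r)) :
  (forall v, p v = 0 <-> exists u : 'rV[R]_s, v = u *m A) ->
  (forall i, p (row i Z) = 0) -> exists U, Z = U *m A.
Proof.
move=> pker pZ; have [U ZU] := choice (fun i => (pker _).1 (pZ i)).
by exists (\matrix_i U i); apply/row_matrixP => i; rewrite row_mul rowK -ZU.
Qed.

(** Fitting's lemma. The rows of [A 0; -X 1] generate the relations among the
   union of the two generating systems, where [X] writes the second system in
   terms of the first. Adding to [B] the relations [1 -Y] that write the first
   system in terms of the second keeps the minors of [B] as minors of larger
   size, and produces rows that are combinations of those of [A 0; -X 1]; so
   Cauchy-Binet applies, and then Laplace expansion along the rows [-X 1]. *)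
Lemma fitting_lemma s r (A : 'M[R]_(s, r)) m n (B : 'M[R]_(n, m))
    (q : {linear 'rV[R]_m -> M}) j :
  presents M A -> (forall y, exists v, q v = y) ->
  (forall i, q (row i B) = 0) ->
  minors_ideal (m - j) B `<=` minors_ideal (r - j) A.
Proof.
move=> [p [ponto pker]] qonto qB.
have [X pX] := lift_linear q ponto; have [Y qY] := lift_linear p qonto.
have [|U1 U1A] := kernel_rows (Z := 1%:M - Y *m X) pker.
  by move=> i; rewrite linearB /= row_mul linearB /= pX row1 rowE qY subrr.
have [|U2 U2A] := kernel_rows (Z := B *m X) pker.
  by move=> i; rewrite row_mul pX qB.
case: (leqP r j) => [|ltjr].
  by move=> /eqP-> x _; apply: minors_ideal0.
set n' := (m - j)%N; apply: ideal_span_subset => _ [f [g [_ _ ->]]].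
pose Bf := rowsub f B; pose E : 'M[R]_(m, n') := colsub g 1%:M.
have subE k (Z : 'M[R]_(k, m)) : Z *m E = colsub g Z.
  by rewrite -[in RHS](mulmx1 Z); apply/matrixP=> a b; rewrite !mxE;
     apply: eq_bigr => c _; rewrite !mxE.
pose W := block_mx 1%:M (- Y *m E) 0 (Bf *m E).
have -> : mxsub f g B = Bf *m E.
  by rewrite subE; apply/matrixP=> a b; rewrite !mxE.
have -> : \det (Bf *m E) = \det W by rewrite det_ublock det1 mul1r.
have {W}-> : W = block_mx U1 (- Y) (rowsub f U2) Bf *m block_mx A 0 (- X) E.
  have U2f : rowsub f U2 *m A = Bf *m X.
    by apply/row_matrixP=> i; rewrite !row_mul !row_rowsub -!row_mul U2A.
  rewrite mulmx_block !mulmx0 !add0r -U1A U2f mulNmx !mulmxN opprK.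
  by rewrite subrK subrr.
rewrite det_mulmx_rows; apply: ideal_span_sum => h; apply: ideal_spanM.
rewrite (_ : rowsub h _ = mxsub h id (block_mx A 0 (- X) E)) //.
case: (EM (injective h)) => [hinj|hninj]; last first.
  by rewrite det_mxsub_noninj; [apply: ideal_span0 | case].
apply: minor_block_lower; have := sum_lower_leq hinj; rewrite /n'; lia.
Qed.

(** Without a presentation the Fitting ideal would be a default value; with one,
   it comes from some presentation [A], about which nothing else is known. *)
Lemma fitting_presented j s0 r0 (A0 : 'M[R]_(s0, r0)) :
  presents M A0 -> exists s r (A : 'M[R]_(s, r)),
    presents M A /\ fitting M j = minors_ideal (r - j) A.
Proof.
move=> MA0; pose P := [set J : set R | exists (s r : nat) (A : 'M[R]_(s, r)),
         presents M A /\ J = minors_ideal (r - j) A].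
by apply: (getPex (P := P)); exists (minors_ideal (r0 - j) A0), s0, r0, A0.
Qed.

End Presentations.

(** * Finite presentation over a Noetherian ring *)

Lemma generator_in (R : comNzRingType) (I : submodClosed R^o) m (g : 'I_m -> R) :
  (forall x, x \in I <-> exists c : 'I_m -> R, x = \sum_(i < m) c i * g i) ->
  forall i, g i \in I.
Proof.
move=> gP i; apply/gP; exists (fun l => (l == i)%:R).
by rewrite (bigD1 i) //= eqxx mul1r big1 ?addr0 // => l /negPf->; rewrite mul0r.
Qed.

Section Noetherian.
Variable R : comNzRingType.
Hypothesis noethR : noetherian R.

Definition submodule_set (V : lmodType R) (P : set V) :=
  P 0 /\ forall a u v, P u -> P v -> P (a *: u + v).

Lemma ideal_of_set (P : set R^o) : submodule_set P ->
  exists I : submodClosed R^o, forall x, x \in I <-> P x.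
Proof.
move=> [P0 PD]; pose S : {pred R^o} := fun x => `[<P x>].
have Sclosed : submod_closed S.
  by split=> [|a u v /asboolP Pu /asboolP Pv]; apply/asboolP => //; apply: PD.
pose I : submodClosed R^o :=
  HB.pack S (GRing.isSubmodClosed.Build R R^o S Sclosed).
by exists I => x; split=> /asboolP.
Qed.

(** By induction on the rank: the first coordinates of a submodule of [R^(m+1)]
   form an ideal, and its elements with first coordinate [0] a submodule of
   [R^m]. *)
Lemma noetherian_row_submodule m (P : set 'rV[R]_m) : submodule_set P ->
  exists s (A : 'M[R]_(s, m)), forall v, P v <-> exists u : 'rV_s, v = u *m A.
Proof.
elim: m P => [|m IHm]; last rewrite -[m.+1]/(1 + m)%N; move=> P [P0 PD].
  exists 0%N, 0 => v; rewrite [v]thinmx0; split=> [_|//].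
  by exists 0; rewrite mulmx0.
have PB (u v : 'rV_(1 + m)) : P u -> P v -> P (v - u).
  by move=> Pu Pv; rewrite addrC -scaleN1r; apply: PD.
have consD a (x y : R) (u v : 'rV_m) :
    a *: row_mx (x%:M : 'M_1) u + row_mx y%:M v =
      row_mx (a * x + y)%:M (a *: u + v).
  by rewrite scale_row_mx add_row_mx scale_scalar_mx raddfD.
pose P1 : set R^o := fun x => exists v : 'rV_m, P (row_mx (x%:M : 'M_1) v).
have [|I IP] := @ideal_of_set P1.
  split=> [|a x y [u Pu] [v Pv]]; first by exists 0; rewrite raddf0 row_mx0.
  by exists (a *: u + v); rewrite -consD; apply: PD.
have [|s [A AP]] := IHm (fun v => P (row_mx (0%:M : 'M_1) v)).
  split=> [|a u v Pu Pv]; first by rewrite raddf0 row_mx0.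
  by have := PD a _ _ Pu Pv; rewrite consD mulr0 addr0.
have [k [g gP]] := noethR I.
have Pg i : P1 (g i) by apply/IP/(generator_in gP).
have [V PV] := choice Pg.
(* The rows of [N] lift generators of the ideal of first coordinates. *)
pose N : 'M_(k, 1 + m) := row_mx (\col_i g i) (\matrix_i V i).
have PN (u : 'rV_k) : P (u *m N).
  rewrite mulmx_sum_row; elim/big_ind: _ => [||i _]; first exact: P0.
    by move=> x y Px Py; rewrite -[x]scale1r; apply: PD.
  rewrite -[_ *: _]addr0; apply: PD => //.
  rewrite row_row_mx rowK (_ : row i _ = (g i)%:M); first exact: PV.
  by apply/rowP=> l; rewrite !mxE !ord1.
exists (k + s)%N, (col_mx N (row_mx 0 A)) => v; split=> [Pv|[w ->]].
  have [|c v1] := (gP (lsubmx (v : 'rV_(1 + m)) 0 0)).1.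
    apply/IP; exists (rsubmx (v : 'rV_(1 + m))).
    by rewrite -mx11_scalar hsubmxK.
  pose cr : 'rV_k := \row_i c i.
  have dE : v - cr *m N = row_mx (0%:M : 'M_1) (rsubmx (v - cr *m N : 'rV_(1 + m))).
    rewrite -[X in row_mx X _](_ : lsubmx (v - cr *m N : 'rV_(1 + m)) = _) ?hsubmxK //.
    rewrite [LHS]mx11_scalar; congr (_%:M).
    rewrite linearB /= mul_mx_row row_mxKl mxE v1.
    rewrite !mxE; under [X in _ - X]eq_bigr => i _ do rewrite !mxE.
    by rewrite subrr.
  have [|u uA] := (AP (rsubmx (v - cr *m N : 'rV_(1 + m)))).1.
    by rewrite -dE; apply: PB.
  exists (row_mx cr u); rewrite mul_row_col [u *m _]mul_mx_row mulmx0 -uA.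
  by rewrite -[0](raddf0 (@scalar_mx R 1)) -dE addrC subrK.
rewrite -[w]hsubmxK mul_row_col -[X in X + _]scale1r.
apply: PD; first exact: PN.
rewrite [_ *m _]mul_mx_row mulmx0 -[0](raddf0 (@scalar_mx R 1)); apply/AP.
by exists (rsubmx w).
Qed.

End Noetherian.

Lemma noetherian_kernel (R : comNzRingType) (M : lmodType R) m
    (q : {linear 'rV[R]_m -> M}) : noetherian R ->
  exists s (A : 'M[R]_(s, m)), forall v, q v = 0 <-> exists u : 'rV_s, v = u *m A.
Proof.
move=> noethR; apply: (noetherian_row_submodule noethR (P := fun v => q v = 0)).
by split=> [|a u v qu qv]; rewrite ?linear0 // linearP qu qv scaler0 addr0.
Qed.

(** * Products of trace elements are minors of relations *)

(** Choose [b 0], [b 1], ... greedily: [b k] must avoid [k] earlier values and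
   the [n - k] values [h l] with [k <= l], besides [E]. The set [E] carries the
   values chosen so far through the induction, so that [#|E| + n] stays constant
   along it. *)
Lemma avoiding_injection n m (h : 'I_n -> 'I_m) (E : {set 'I_m}) :
  ((0 < n)%N -> (#|E| + n < m)%N) ->
  exists b : 'I_n -> 'I_m, [/\ injective b, forall l, b l \notin E
    & forall k l : 'I_n, (k <= l)%N -> b k != h l].
Proof.
elim: n h E => [|n IHn] h E Em.
  have no_ord (i : 'I_0) : 'I_m by case: i.
  by exists no_ord; split; case.
have /subsetPn[b0 _] : ~~ (([set: 'I_m] \subset E :|: [set h l | l : 'I_n.+1])%SET).
  apply/negP => /subset_leq_card; rewrite leqNgt cardsT card_ord => /negP; apply.
  apply: leq_ltn_trans (Em isT); apply: leq_trans (leq_card_setU _ _) _.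
  by rewrite leq_add2l (leq_trans (leq_imset_card _ _)) // cardT size_enum_ord.
rewrite inE negb_or => /andP[b0E b0h].
have [_|b [binj bE bh]] := IHn (h \o lift ord0) (b0 |: E)%SET.
  by have := Em isT; rewrite cardsU1 b0E /=; lia.
exists (fun i => if unlift ord0 i is Some j then b j else b0); split.
- move=> i j; case: unliftP => [i'|] ->; case: unliftP => [j'|] ->.
  + by move/binj ->.
  + by move=> bb0; have := bE i'; rewrite bb0 !inE eqxx.
  + by move=> bb0; have := bE j'; rewrite -bb0 !inE eqxx.
  + by [].
- by move=> l; case: unliftP => [l'|] _ //; have := bE l'; rewrite !inE negb_or => /andP[].
- move=> k l; case: unliftP => [k'|] -> kl.
    by case: (unliftP ord0 l) kl => [l'|] -> // kl; apply: bh.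
  by apply: contraNneq b0h => ->; apply: imset_f.
Qed.

Section TracePowers.
Variables (R : comNzRingType) (M : lmodType R).

Section FormCombination.
Variables (n : nat) (c : 'I_n -> R) (phi : 'I_n -> {linear M -> R^o}).

Definition form_combination (x : M) : R^o := \sum_i c i * phi i x.

Lemma form_combination_is_linear : linear form_combination.
Proof.
move=> a x y; rewrite /form_combination scaler_sumr -big_split /=.
by apply: eq_bigr => i _; rewrite linearP mulrDr mulrCA.
Qed.

HB.instance Definition _ := GRing.isLinear.Build R M R^o *:%R form_combination
  form_combination_is_linear.

End FormCombination.

Lemma trace_generators m (G : 'I_m -> M) a :
  (forall y, exists v, combination G v = y) -> trace M a ->
  exists psi : 'I_m -> {linear M -> R^o}, a = \sum_i psi i (G i).
Proof.
move=> Gonto [n [phi [x ->]]]; have [v vx] := choice (fun k => Gonto (x k)).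
exists (fun i => form_combination (fun k => v k 0 i) phi).
rewrite exchange_big; apply: eq_bigr => /= k _.
by rewrite -vx linear_sum; apply: eq_bigr => i _; rewrite linearZ.
Qed.

Lemma trace_ideal_span m (G : 'I_m -> M) :
  (forall y, exists v, combination G v = y) ->
  ideal_span (trace M) `<=` trace M.
Proof.
move=> Gonto _ [n [c [a [tra ->]]]].
have [psi aE] := choice (fun k => trace_generators Gonto (tra k)).
exists m, (fun i => form_combination c (psi^~ i)), G.
rewrite /= /form_combination exchange_big; apply: eq_bigr => /= k _.
by rewrite aE big_distrr.
Qed.

(** This is all that is used of an ideal, where it holds because
   [y * phi x = phi (y * x) = x * phi y]. *)
Hypothesis linear_form_swap :
  forall (phi : {linear M -> R^o}) x y, phi x *: y = phi y *: x.

(** A product of values [chi l (G (h l))] is the determinant of a triangular block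
   of the relations [chi l (G (h l)) e_(b l) - chi l (G (b l)) e_(h l)]. The
   condition on [j] leaves room for the choice of [b]. *)
Lemma trace_power_sub_minors s r (A : 'M[R]_(s, r)) m (G : 'I_m -> M) j :
  presents M A -> (forall y, exists v, combination G v = y) ->
  ((0 < m - j)%N -> (0 < j)%N) ->
  ideal_power (trace M) (m - j) `<=` minors_ideal (r - j) A.
Proof.
move=> MA Gonto nj; set n := (m - j)%N.
apply: ideal_span_subset => _ [f trf ->].
have [psi fE] := choice (fun l => trace_generators Gonto (trf l)).
rewrite (eq_bigr _ (fun l _ => fE l)) bigA_distr_bigA /=.
apply: ideal_span_sum => h.
pose chi l := psi l (h l).
have [|b [binj _ bh]] := @avoiding_injection n m h finset.set0.
  by rewrite cards0 /n => n0; have := nj n0; lia.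
pose B : 'M[R]_(n, m) := \matrix_(l, i) (chi l (G (h l)) * (i == b l)%:R
  - chi l (G (b l)) * (i == h l)%:R).
have -> : \prod_l psi l (h l) (G (h l)) = \det (mxsub id b B).
  rewrite -det_tr det_trig.
    apply: eq_bigr => l _; rewrite !mxE eqxx mulr1.
    by rewrite (negPf (bh l l _)) // mulr0 subr0.
  apply/is_trig_mxP => k l kl; rewrite !mxE (inj_eq binj).
  by rewrite (negPf (bh k l (ltnW kl))) [k == l]ltn_eqF // !mulr0 subr0.
apply: (fitting_lemma (q := combination G) MA) (minor_in_ideal _ _ _) => // l.
have pick (a : R) i0 : \sum_i (a * (i == i0)%:R) *: G i = a *: G i0.
  rewrite (bigD1 i0) //= eqxx mulr1 big1 ?addr0 // => i /negPf->.
  by rewrite mulr0 scale0r.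
rewrite /= /combination; under eq_bigr => i _ do rewrite !mxE scalerBl.
by rewrite sumrB !pick linear_form_swap subrr.
Qed.

End TracePowers.

(** * Ideals *)

Section IdealModule.
Variables (R : comNzRingType) (I : submodClosed R^o).

Lemma ideal_form_swap (phi : {linear submodule I -> R^o}) x y :
  phi x *: y = phi y *: x.
Proof.
have swap : val y *: x = val x *: y :> submodule I.
  by apply: val_inj; rewrite !linearZ /= [LHS]mulrC.
have := congr1 phi swap; rewrite !linearZ /= => phi_swap.
by apply: val_inj; rewrite !linearZ /= [LHS]mulrC [RHS]mulrC.
Qed.

Lemma ideal_generators m : generated_by m I ->
  exists G : 'I_m -> submodule I, forall y, exists v, combination G v = y.
Proof.
move=> [g gP].
have Ig i := generator_in gP i.
exists (fun i => Submodule (Ig i)) => y.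
have [c yc] := (gP (val y)).1 (valP y).
exists (\row_i c i); apply: val_inj; rewrite yc linear_sum.
by apply: eq_bigr => i _; rewrite linearZ mxE.
Qed.

End IdealModule.

Lemma ideal_power0 (R : comNzRingType) (J : set R) x : ideal_power J 0 x.
Proof.
rewrite -[x]mulr1; apply: ideal_spanM; apply: sub_ideal_span.
by exists (fun=> 0); [case | rewrite big_ord0].
Qed.

Lemma sub_ideal_power1 (R : comNzRingType) (J : set R) :
  J `<=` ideal_power J 1.
Proof.
move=> x Jx; apply: sub_ideal_span.
by exists (fun=> x); [| rewrite big_ord1].
Qed.

Section TwoGenerators.
Variables (R : idomainType) (I : submodClosed R^o).
Variables (G : 'I_2 -> submodule I).
Hypothesis Gonto : forall y, exists v, combination G v = y.

(** A relation [c] yields the form on [I] that sends [G 0] to [c 1] and [G 1] to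
   [- c 0]: when the generators are nonzero, it is multiplication by the
   common value of the fractions [c 1 / G 0] and [- c 0 / G 1]. On a vector [v] of
   coefficients it is the determinant of [v] and [c], which vanishes for a
   relation [v] because the relations between two generators of a nonzero ideal
   form a module of rank one. *)
Lemma relation_entry_trace (c : 'rV[R]_2) i : ~ (I =i pred1 0) ->
  combination G c = 0 -> trace (submodule I) (c 0 i).
Proof.
move=> Inz Gc.
have lift01 : lift 0 0 = 1 :> 'I_2 by apply: val_inj.
pose det_c (v : 'rV_2) : R := v 0 0 * c 0 1 - v 0 1 * c 0 0.
have relE (v : 'rV_2) : combination G v = 0 ->
    v 0 0 * val (G 0) + v 0 1 * val (G 1) = 0.
  move=> /(congr1 val); rewrite linear_sum big_ord_recl big_ord1 !linearZ /=.
  by rewrite lift01.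
have det_rel v : combination G v = 0 -> det_c v = 0.
  move=> Gv; have [k Gk] : exists k, val (G k) != 0.
    apply: contrapT => G0; apply: Inz => x; rewrite inE.
    apply/idP/eqP => [Ix|->]; last exact: rpred0.
    have [u Gu] := Gonto (Submodule Ix).
    rewrite -[x]/(val (Submodule Ix)) -Gu linear_sum big1 // => k _.
    rewrite linearZ /=.
    by case: (eqVneq (val (G k)) 0) => [->|Gk]; [rewrite scaler0 |
      case: G0; exists k].
  apply: (mulIf Gk); rewrite mul0r /det_c.
  case: (unliftP 0 k) => [k'|] ->; rewrite ?(ord1 k') ?lift01.
    transitivity (v 0 0 * (c 0 0 * val (G 0) + c 0 1 * val (G 1))
                  - c 0 0 * (v 0 0 * val (G 0) + v 0 1 * val (G 1))); first by ring.
    by rewrite !relE // !mulr0 subrr.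
  transitivity (c 0 1 * (v 0 0 * val (G 0) + v 0 1 * val (G 1))
                - v 0 1 * (c 0 0 * val (G 0) + c 0 1 * val (G 1))); first by ring.
  by rewrite !relE // !mulr0 subrr.
(* Hence [det_c] descends along [combination G]; [w] picks coefficients. *)
have [w wG] := choice Gonto.
have det_w v : det_c (w (combination G v)) = det_c v.
  apply/eqP; rewrite -subr_eq0; apply/eqP.
  rewrite -(det_rel (w (combination G v) - v)); last by rewrite linearB /= wG subrr.
  by rewrite /det_c !mxE; ring.
pose phi (x : submodule I) : R^o := det_c (w x).
have phi_linear : linear phi.
  move=> a x y; rewrite -[in LHS](wG x) -[in LHS](wG y) -linearP /phi det_w.
  by rewrite /det_c !mxE /GRing.scale /=; ring.
pose phiL : {linear submodule I -> R^o} :=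
  HB.pack phi (GRing.isLinear.Build R (submodule I) R^o *:%R phi phi_linear).
have comb_delta k : combination G 'e_k = G k.
  rewrite /combination (bigD1 k) //= mxE !eqxx scale1r big1 ?addr0 // => l lk.
  by rewrite mxE (negPf lk) andbF scale0r.
have phiG k : phiL (G k) = det_c 'e_k by rewrite -[G k]comb_delta /= /phi det_w.
case: (unliftP 0 i) => [i'|] ->.
  exists 1, (fun=> phiL), (fun=> G 0); rewrite big_ord1 phiG /det_c !mxE /=.
  by rewrite (ord1 i') lift01; ring.
exists 1, (fun=> phiL), (fun=> - G 1); rewrite big_ord1 linearN phiG /det_c !mxE /=.
by ring.
Qed.

End TwoGenerators.

(** * The trace of an ideal and its Fitting ideals *)

Theorem proposition1p7 (R : idomainType) (noethR : noetherian R)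
    (I : submodClosed R^o) :
  (forall m j : nat, generated_by m I ->
     (0 < j)%N \/ I =i pred1 (0 : R) ->
     ideal_power (trace (submodule I)) (m - j) `<=` fitting (submodule I) j) /\
  (generated_by 2 I -> ~ (I =i pred1 (0 : R)) ->
     fitting (submodule I) 1 = trace (submodule I)).
Proof.
have presented m (G : 'I_m -> submodule I) :
    (forall y, exists v, combination G v = y) -> exists s (A : 'M[R]_(s, m)),
    presents (submodule I) A /\ forall i, combination G (row i A) = 0.
  move=> Gonto; have [s [A GA]] := noetherian_kernel (combination G) noethR.
  exists s, A; split; first by exists (combination G).
  by move=> i; apply/GA; exists 'e_i; rewrite -rowE.
have trace_power_fitting m j : generated_by m I -> ((0 < m - j)%N -> (0 < j)%N) ->
    ideal_power (trace (submodule I)) (m - j) `<=` fitting (submodule I) j.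
  move=> /ideal_generators[G Gonto] nj.
  have [s0 [A0 [IA0 _]]] := presented _ _ Gonto.
  have [s [r [A [IA ->]]]] := fitting_presented j IA0.
  exact: trace_power_sub_minors (@ideal_form_swap _ I) _ _ _ _ _ _ IA Gonto nj.
split=> [m j genI [j_gt0|I0]|genI Inz].
- exact: trace_power_fitting.
- (* The zero ideal is also generated by the empty family, for which the power
     of the trace on the left is the unit ideal. *)
  move=> x _; apply: (trace_power_fitting 0%N j) => //; last exact: ideal_power0.
  exists (fun=> 0) => y; rewrite I0 inE; split=> [/eqP->|[c ->]].
    by exists (fun=> 0); rewrite big_ord0.
  by rewrite big_ord0.
apply/seteqP; split=> [x|x trx]; last first.
  by apply: (trace_power_fitting 2%N 1%N) => //; apply: sub_ideal_power1.
have [G Gonto] := ideal_generators genI.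
have [s0 [A0 [IA0 GA0]]] := presented _ _ Gonto.
have [s [r [A [[p [ponto pA]] ->]]]] := fitting_presented 1 IA0.
have pA0 i : p (row i A) = 0 by apply/pA; exists 'e_i; rewrite -rowE.
move=> /(fitting_lemma IA0 ponto pA0) xA0; apply: (trace_ideal_span Gonto).
move: x xA0; apply: ideal_span_subset => _ [f [g [_ _ ->]]]; apply: sub_ideal_span.
rewrite det_mx11 mxE.
by have := relation_entry_trace Gonto (g 0) Inz (GA0 (f 0)); rewrite mxE.
Qed.
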